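(* Let $V$ be a finite-dimensional real vector space and let $\mathcal{P}:V\to\mathbb{R}$ be a homogeneous polynomial of degree $k$ which is hyperbolic with respect to some $e\in V$, with hyperbolicity cone $\Gamma(\mathcal{P};e)$. Assume that a finite group $G$ acts linearly on $V$ such that (i) $g\cdot e=e$ for all $g\in G$; (ii) $\mathcal{P}(g\cdot x)=\mathcal{P}(x)$ for all $g\in G$ and all $x\in V$. Let $\mathcal{R}_G(x)=\frac{1}{|G|}\sum_{g\in G}g\cdot x$. Then, for every $x\in\Gamma(\mathcal{P};e)$, (a) $g\cdot x\in\Gamma(\mathcal{P};e)$ for all $g\in G$, and $\mathcal{R}_G(x)\in\Gamma(\mathcal{P};e)$; (b) $\mathcal{P}(\mathcal{R}_G(x))\ge\mathcal{P}(x)$; equivalently, $\mathcal{P}(\mathcal{R}_G(x))^{1/k}\ge\mathcal{P}(x)^{1/k}$, i.e. the concave function $\mathcal{P}^{1/k}$ is monotone under symmetrization by $G$ on $\Gamma(\mathcal{P};e)$.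
   Context: A homogeneous real polynomial $\mathcal{P}$ of degree $k$ on a finite-dimensional real vector space $V$ is hyperbolic with respect to $e\in V$ if $\mathcal{P}(e)>0$ and, for every $x\in V$, the univariate polynomial $t\mapsto\mathcal{P}(te+x)$ has only real zeros. In that case $\mathcal{P}(te+x)=\mathcal{P}(e)\prod_{i=1}^k(t+\lambda_i(\mathcal{P};e,x))$ with real numbers $\lambda_i(\mathcal{P};e,x)$, and the hyperbolicity cone is $\Gamma(\mathcal{P};e)=\{x\in V:\lambda_i(\mathcal{P};e,x)>0\text{ for all }i=1,\dots,k\}$. Note that $\mathcal{P}>0$ on this cone; here $k\ge1$, as is implicit in $\mathcal{P}^{1/k}$. The linear map $\mathcal{R}_G:V\to V$ is called the Reynolds operator (group average) of $G$. *)

(* Defs.v *)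
From HB Require Import structures.
From mathcomp Require Import all_boot all_order all_algebra all_fingroup.
From mathcomp Require Import all_classical all_reals all_analysis.
From mathcomp Require Import complex.
(* The notations of mpoly clash with those of MathComp-Analysis. *)
From mathcomp Require Import -(notations) mpoly.

Set Implicit Arguments.
Unset Strict Implicit.
Unset Printing Implicit Defensive.

Import Order.TTheory GRing.Theory Num.Theory.

Local Open Scope classical_set_scope.
Local Open Scope ring_scope.

Section Hyperbolicity.
Context (R : realType) (V : vectType R).
Implicit Types (P : V -> R) (k : nat) (e x : V).

(* The coordinates are taken in the basis [vbasis fullv]; being a homogeneous
   polynomial of degree k in the coordinates does not depend on the basis. *)
Definition homogeneous_polynomial k P :=
  exists2 p : mpoly (\dim {:V}) R,
    p \is ishomog1 k mdeg &
    forall x, P x = meval (fun i => coord (vbasis {:V}) i x) p.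

(* The polynomial q is determined by its values, R being infinite; its zeros
   range over the complex numbers R[i]. *)
Definition hyperbolic P e :=
  0 < P e /\
  forall x, exists2 q : {poly R},
    forall t, q.[t] = P (t *: e + x) &
    forall z : R[i], root (map_poly (real_complex R) q) z -> complex.Im z = 0.

(* The numbers lambda_i(P; e, x), determined only up to order: xget picks one
   ordering. The default 0 is used only if there is no such factorization, which
   does not happen for P homogeneous of degree k and hyperbolic w.r.t. e. *)
Definition hyp_eigenvalue k P e x : 'I_k -> R :=
  xget (fun=> 0) [set l : 'I_k -> R |
    forall t, P (t *: e + x) = P e * \prod_(i < k) (t + l i)].

Definition hyperbolicity_cone k P e : set V :=
  [set x | forall i : 'I_k, 0 < hyp_eigenvalue P e x i].

End Hyperbolicity.

Section LinearActions.
Context (R : realType) (V : vectType R) (gT : finGroupType).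

Definition linear_action (rho : gT -> 'End(V)) :=
  rho 1%g = \1%VF /\ forall g h, rho (g * h)%g = (rho g \o rho h)%VF.

Definition reynolds (rho : gT -> 'End(V)) (x : V) : V :=
  #|gT|%:R^-1 *: \sum_(g : gT) rho g x.

End LinearActions.

(* Main.v *)
Require Import Defs.
From mathcomp Require Import all_boot all_order all_algebra all_fingroup.
From mathcomp Require Import all_classical all_reals all_analysis.
From mathcomp Require Import complex ring lra.
From mathcomp Require Import -(notations) mpoly.

(** The statement rests on two theorems of Garding: the hyperbolicity cone
    [cone] of [P] is convex, and [F := P `^ k%:R^-1] is concave on it. Granted
    these, the orbit of a point [x] of [cone] stays in [cone], because
    [P (t *: e + rho g x) = P (rho g (t *: e + x)) = P (t *: e + x)], so that
    [rho g x] has the eigenvalues of [x]; the average of the orbit is in [cone]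
    by convexity, and [F] of it is at least the average of the equal numbers
    [F (rho g x) = F x].

    Both theorems follow from a statement on a single line: if [a] and [b] lie
    in [cone], then [t |-> P (t *: a + b)] has only real negative zeros. It
    is then a product [P a * \prod_i (t + mu i)] with [mu i > 0]; at [t = 1]
    it does not vanish, even after [b] is moved in the direction [e], which
    puts [a + b] in [cone] ([cone_add]); and comparing the values at [t = 0] and
    [t = 1], the AM-GM inequality gives [F a + F b <= F (a + b)]
    ([root_superadditive]). As [cone] is a cone and [F] is homogeneous of
    degree 1, these are convexity and concavity.

    The zeros on the line are located by deforming polynomials over the complex
    numbers. The tool is [root_free_homotopy]: if the coefficients of a
    polynomial in [t] move continuously with [s], the leading one staying fixed
    and nonzero, and if no zero ever crosses the real axis, then having no zero
    in the closed upper half-plane is a condition both open and closed on [s].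
    It is used twice.
    - The zeros [t] of [P (i alpha e + s y + t a)], for [alpha > 0], cannot be
      real since [P] is hyperbolic with respect to [e]; at [s = 0] they have
      negative imaginary parts since [a] is in [cone]. So they still have at
      [s = 1]. Letting [alpha] tend to 0 shows that [P (y + t a)] has no zero
      in the open upper half-plane: [P] is hyperbolic with respect to [a]
      ([hyperbolic_in_cone]).
    - Hence the zeros [t] of [P ((1 - s) e + s b - i t a)] cannot be real, and
      at [s = 0] they lie in the lower half-plane; so do they at [s = 1], which
      excludes the zeros [t >= 0] of [P (t a + b)] ([cone_ray_neq0]). *)

Set Implicit Arguments.
Unset Strict Implicit.
Unset Printing Implicit Defensive.

Import Order.TTheory GRing.Theory Num.Theory.
Import numFieldNormedType.Exports.

Local Open Scope classical_set_scope.
Local Open Scope complex_scope.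
Local Open Scope ring_scope.

(** * Polynomials over the complex numbers *)

Lemma prodr_const_seq (A : comNzRingType) (T : Type) (s : seq T) (x : A) :
  \prod_(r <- s) x = x ^+ size s.
Proof. by elim: s => [|r s IH]; rewrite ?big_nil // big_cons IH exprS. Qed.

Section ComplexPolynomials.
Context (R : realType).
Local Notation normc := (@Normc.normc R).
Local Notation Re := (@complex.Re R).
Local Notation Im := (@complex.Im R).
Implicit Types (z w : R[i]) (p : {poly R[i]}).

Lemma normc_ge0 z : 0 <= normc z.
Proof. by case: z => a b; rewrite sqrtr_ge0. Qed.

Lemma normc_gt0 z : (0 < normc z) = (z != 0).
Proof.
rewrite lt0r normc_ge0 andbT; congr (~~ _).
by apply/eqP/eqP => [/Normc.eq0_normc //|->]; rewrite Normc.normc0.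
Qed.

Lemma normc_sqrt z : normc z = Num.sqrt (Re z ^+ 2 + Im z ^+ 2).
Proof. by case: z. Qed.

Lemma ler_normcD z w : normc (z + w) <= normc z + normc w.
Proof. exact: le_normcD. Qed.

Lemma ler_normIm z : `|Im z| <= normc z.
Proof. by rewrite normc_sqrt -sqrtr_sqr ler_wsqrtr // lerDr sqr_ge0. Qed.

Lemma normc_prod (s : seq R[i]) (F : R[i] -> R[i]) :
  normc (\prod_(r <- s) F r) = \prod_(r <- s) normc (F r).
Proof. exact: (big_morph normc (@Normc.normcM R) (Normc.normc1 R)). Qed.

Lemma normcX z n : normc (z ^+ n) = normc z ^+ n.
Proof.
by elim: n => [|n IH]; rewrite ?Normc.normc1 // !exprS Normc.normcM IH.
Qed.

Lemma ler_normc_sum n (F : 'I_n -> R[i]) :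
  normc (\sum_i F i) <= \sum_i normc (F i).
Proof.
elim/big_ind2: _ => //= [|x1 x2 y1 y2 h1 h2].
  by rewrite expr0n addr0 sqrtr0.
by apply: le_trans (ler_normcD _ _) (lerD h1 h2).
Qed.

(** Real and imaginary parts turn a complex polynomial on the real line into
    real polynomials, whose continuity is known. *)
Lemma Re_horner p (s : R) :
  Re p.[s%:C] = (\poly_(j < size p) Re p`_j).[s].
Proof.
rewrite horner_poly horner_coef.
rewrite (big_morph Re (id1 := 0) (op1 := +%R)) //; last by case=> a b [].
apply: eq_bigr => j _.
by rewrite -rmorphXn /=; case: (p`_j) => a b /=; rewrite mulr0 subr0.
Qed.

Lemma Im_horner p (s : R) :
  Im p.[s%:C] = (\poly_(j < size p) Im p`_j).[s].
Proof.
rewrite horner_poly horner_coef.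
rewrite (big_morph Im (id1 := 0) (op1 := +%R)) //; last by case=> a b [].
apply: eq_bigr => j _.
by rewrite -rmorphXn /=; case: (p`_j) => a b /=; rewrite mulr0 add0r.
Qed.

Lemma continuous_normc_horner p : continuous (fun s : R => normc p.[s%:C]).
Proof.
have -> : (fun s : R => normc p.[s%:C]) = Num.sqrt \o
    horner ((\poly_(j < size p) Re p`_j) ^+ 2 +
            (\poly_(j < size p) Im p`_j) ^+ 2).
  apply/funext => s /=.
  by rewrite normc_sqrt hornerD !horner_exp -Re_horner -Im_horner.
move=> s; apply: continuous_comp; first exact: continuous_horner.
exact: sqrt_continuous.
Qed.

Lemma closed_normc_horner_ge p (c : R) :
  closed [set s : R | c <= normc p.[s%:C]].
Proof.
apply: (@preimage_closed _ _ (fun s : R => normc p.[s%:C]) [set x | c <= x]).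
  by move=> s _; exact: continuous_normc_horner.
exact: closed_ge.
Qed.

Lemma horner_split p k : (size p <= k.+1)%N -> p`_k != 0 ->
  exists2 s : seq R[i], size s = k &
    forall t, p.[t] = p`_k * \prod_(r <- s) (t - r).
Proof.
move=> sp pk; have [s Dp] := closed_field_poly_normal p.
have szp : size p = k.+1.
  by apply/eqP; rewrite eqn_leq sp ltnNge; apply: contra pk => /leq_sizeP ->.
have lc : lead_coef p = p`_k by rewrite lead_coefE szp.
exists s; last first.
  move=> t; rewrite {1}Dp hornerZ lc horner_prod; congr (_ * _).
  by apply: eq_bigr => r _; rewrite !hornerE.
move: szp; rewrite {1}Dp size_scale ?lc //.
by rewrite size_prod_XsubC => -[].
Qed.

(** Every root lies below the real axis, so the distance from [t] to it exceeds
    [Im t]. This inequality passes to limits of polynomials with a fixed leading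
    coefficient, whereas the absence of roots by itself does not. *)
Lemma normc_horner_ge p k : (size p <= k.+1)%N -> p`_k != 0 ->
  (forall t, 0 <= Im t -> p.[t] != 0) ->
  forall t, 0 <= Im t -> normc p`_k * Im t ^+ k <= normc p.[t].
Proof.
move=> sp pk nz t t0; have [s ss Dp] := horner_split sp pk.
rewrite Dp Normc.normcM ler_wpM2l ?normc_ge0 //.
rewrite normc_prod -ss -prodr_const_seq big_seq [leRHS]big_seq.
apply: ler_prod => r rs; rewrite t0 /=.
have : Im r < 0.
  rewrite ltNge; apply/negP => /nz /negP; apply; rewrite Dp.
  by rewrite (big_rem r) //= subrr mul0r mulr0.
move=> r0; apply: le_trans (ler_normIm _).
rewrite ler_normr; apply/orP; left.
by case: t r t0 r0 {rs} => ? ? [? ?] /= *; lra.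
Qed.

(** The closed upper half-plane is at a positive distance from each root [r], so
    that [normc (t - r)] dominates a multiple of [1 + normc t] there. A
    perturbation of the coefficients by a small relative amount then cannot
    create a root in the half-plane, not even far from the origin. *)
Lemma normc_horner_ge_growth p k : (size p <= k.+1)%N -> p`_k != 0 ->
  (forall t, 0 <= Im t -> p.[t] != 0) ->
  exists2 d : R, 0 < d &
    forall t, 0 <= Im t -> d * (1 + normc t) ^+ k <= normc p.[t].
Proof.
move=> sp pk nz; have [s ss Dp] := horner_split sp pk.
have rt r : r \in s -> Im r < 0.
  move=> rs; rewrite ltNge; apply/negP => /nz /negP; apply; rewrite Dp.
  by rewrite (big_rem r) //= subrr mul0r mulr0.
(* D r bounds normc (t - r) / (1 + normc t) from below, because
     normc (t - r) >= - Im r and normc t <= normc (t - r) + normc r. *)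
pose D r := - Im r / (1 - Im r + normc r).
have D0 r : r \in s -> 0 < D r.
  move=> /rt ?; have := normc_ge0 r => ?; apply: divr_gt0; lra.
exists (normc p`_k * \prod_(r <- s) D r).
  rewrite mulr_gt0 ?normc_gt0 // big_seq_cond prodr_gt0 // => r; rewrite andbT.
  exact: D0.
move=> t t0; rewrite Dp Normc.normcM -mulrA ler_wpM2l ?normc_ge0 //.
rewrite normc_prod -ss -prodr_const_seq -big_split /= big_seq [leRHS]big_seq.
apply: ler_prod => r rs.
have := rt r rs; have := normc_ge0 r; have := normc_ge0 t => n1 n2 n3.
have den : 0 < 1 - Im r + normc r by lra.
have D0r := D0 r rs.
apply/andP; split; first by apply: mulr_ge0; lra.
rewrite /D mulrAC ler_pdivrMr //.
have h1 : - Im r <= normc (t - r).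
  apply: le_trans (ler_normIm _); rewrite ler_normr; apply/orP; left.
  by case: (t) (r) t0 => ? ? [? ?] /= *; lra.
have h2 : normc t <= normc (t - r) + normc r.
  by rewrite -{1}(subrK r t) ler_normcD.
nra.
Qed.

Section Homotopy.
(** A family of polynomials in [t] whose coefficients are polynomials in the
    parameter [s]: the outer indeterminate of [A] is [t], the inner one [s]. *)
Context (A : {poly {poly R[i]}}) (k : nat) (c : R[i]).
Context (szA : (size A <= k.+1)%N) (Ak : A`_k = c%:P) (c0 : c != 0).

Let slice (s : R) : {poly R[i]} := map_poly (horner_eval s%:C) A.

Let sliceE s t : (slice s).[t] = A.[t%:P].[s%:C].
Proof.
rewrite /slice -[in LHS](hornerC t s%:C).
exact: (horner_map (horner_eval s%:C) A t%:P).
Qed.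

Let size_slice s : (size (slice s) <= k.+1)%N.
Proof. exact: leq_trans (size_poly _ _) szA. Qed.

Let slice_lead s : (slice s)`_k = c.
Proof. by rewrite coef_map /= Ak /horner_eval hornerC. Qed.

Let root_free : set R := [set s | forall t, 0 <= Im t -> (slice s).[t] != 0].

(** The growth of the slice at [s0] dominates its change, which is at most
    [g s * (1 + normc t) ^+ k] with [g] continuous and zero at [s0]. *)
Lemma open_root_free : open root_free.
Proof.
rewrite openE => s0 /= nz0; rewrite /interior.
have sk : (slice s0)`_k != 0 by rewrite slice_lead.
have [d d0 Hd] := normc_horner_ge_growth (size_slice s0) sk nz0.
pose g s := \sum_(l < k.+1) normc (A`_l - ((A`_l).[s0%:C])%:P).[s%:C].
have cg : continuous g.
  move=> s; apply: (@continuous_big _ _ +%R 0 predT) => //.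
    by move=> x; exact: add_continuous.
  by move=> l _; exact: continuous_normc_horner.
have g0 : g s0 < d.
  by rewrite /g big1 // => l _; rewrite !hornerE subrr Normc.normc0.
have := cg s0; move/(_ [set x | x < d]) => H.
have {H} : nbhs s0 [set s | g s < d].
  by apply: H; apply: open_nbhs_nbhs; split => //; exact: open_lt.
apply: filterS => s gs t t0.
have diff : normc ((slice s).[t] - (slice s0).[t]) <= g s * (1 + normc t) ^+ k.
  rewrite !(horner_coef_wide _ (size_slice _)) -sumrB /g mulr_suml.
  apply: le_trans (ler_normc_sum _) _; apply: ler_sum => l _.
  rewrite -mulrBl Normc.normcM normcX hornerD hornerN hornerC !coef_map /=.
  rewrite ler_wpM2l ?normc_ge0 //.
  have nt := normc_ge0 t.
  apply: (@le_trans _ _ ((1 + normc t) ^+ l)).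
    by apply: lerXn2r; rewrite ?nnegrE; lra.
  by apply: ler_weXn2l; [lra | rewrite -ltnS].
apply/negP => /eqP st0; move: diff; rewrite st0 sub0r normcN => diff.
have p0 : 0 < (1 + normc t) ^+ k.
  by apply: exprn_gt0; have := normc_ge0 t; lra.
have := le_trans (Hd t t0) diff; rewrite ler_pM2r // leNgt => /negP; exact.
Qed.

(** On the segment the good parameters are also those satisfying the closed
    inequalities of [normc_horner_ge] for all [t] above the real axis, roots on
    the real axis being excluded by hypothesis; the segment is connected. *)
Lemma root_free_homotopy :
  (forall s t : R, 0 <= s <= 1 -> A.[t%:C%:P].[s%:C] != 0) ->
  (forall t, 0 <= Im t -> A.[t%:P].[0] != 0) ->
  forall t, 0 <= Im t -> A.[t%:P].[1] != 0.
Proof.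
move=> Hreal Hstart.
have : `[0, 1] `&` root_free = `[0%R, 1%R]%classic.
  apply: segment_connected.
  - exists 0; split; first by rewrite /= in_itv /= lexx ler01.
    by move=> t t0; rewrite sliceE Hstart.
  - by exists root_free => //; exact: open_root_free.
  - exists (\bigcap_(t in [set t | 0 < Im t])
      [set s : R | normc c * Im t ^+ k <= normc (A.[t%:P]).[s%:C]]).
      by apply: closed_bigI => t _; exact: closed_normc_horner_ge.
    apply/seteqP; split => s [s01 Hs]; split => //.
      move=> t /= t0; rewrite -sliceE -(slice_lead s).
      by apply: normc_horner_ge; rewrite ?slice_lead // ltW.
    move=> t; rewrite le_eqVlt => /orP[/eqP t0|t0].
      move: s01; rewrite /= in_itv /= => /(Hreal s (Re t)).
      by rewrite sliceE; case: t t0 => a b /= <-.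
    rewrite sliceE -normc_gt0; apply: lt_le_trans (Hs t t0).
    by rewrite mulr_gt0 ?normc_gt0 ?exprn_gt0.
move=> E t t0.
have : (`[0, 1] `&` root_free) 1 by rewrite E /= in_itv /= lexx ler01.
by case=> _ /(_ t t0); rewrite sliceE.
Qed.

End Homotopy.

End ComplexPolynomials.

(** * Evaluating a homogeneous polynomial in an extension ring *)

Section HomogeneousEvaluation.
Context (n k : nat) (K : comNzRingType) (p : mpoly n K).
Context (p_homog : p \is ishomog1 k mdeg).

Lemma mmap_rmorph (A B : comNzRingType) (f : {rmorphism K -> A})
    (phi : {rmorphism A -> B}) (z : 'I_n -> A) :
  phi (mmap f z p) = mmap (phi \o f) (phi \o z) p.
Proof.
rewrite /mmap rmorph_sum; apply: eq_bigr => m _; rewrite rmorphM; congr (_ * _).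
by rewrite /mmap1 rmorph_prod; apply: eq_bigr => i _; rewrite rmorphXn.
Qed.

Lemma eq_mmap (A : comNzRingType) (f f' : K -> A) (z z' : 'I_n -> A) :
  f =1 f' -> z =1 z' -> mmap f z p = mmap f' z' p.
Proof.
move=> ff' zz'; rewrite /mmap; apply: eq_bigr => m _; rewrite ff'.
by congr (_ * _); apply: mmap1_eq.
Qed.

Lemma mmap_homog (A : comNzRingType) (f : K -> A) (c : A) (z : 'I_n -> A) :
  mmap f (fun i => c * z i) p = c ^+ k * mmap f z p.
Proof.
rewrite /mmap mulr_sumr big_seq [RHS]big_seq; apply: eq_bigr => m mp.
rewrite mulrCA; congr (_ * _).
have <- : mdeg m = k := dhomogP _ _ _ p_homog m mp.
rewrite mdegE /mmap1 -prodrXr -big_split /=.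
by apply: eq_bigr => i _; rewrite exprMn.
Qed.

Lemma size_coef_prod_linear (A : comNzRingType) (I : Type) (s : seq I)
    (u w : I -> A) (d : I -> nat)
    (q := \prod_(i <- s) ((u i)%:P + (w i)%:P * 'X) ^+ d i) :
  (size q <= (\sum_(i <- s) d i).+1)%N /\
  q`_(\sum_(i <- s) d i) = \prod_(i <- s) w i ^+ d i.
Proof.
have mulD d1 d2 (q1 q2 : {poly A}) l1 l2 :
    (size q1 <= d1.+1)%N /\ q1`_d1 = l1 ->
    (size q2 <= d2.+1)%N /\ q2`_d2 = l2 ->
    (size (q1 * q2)%R <= (d1 + d2).+1)%N /\ (q1 * q2)`_(d1 + d2) = l1 * l2.
  move=> [s1 <-] [s2 <-]; split.
    apply: leq_trans (size_polyMleq _ _) _.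
    by rewrite -subn1 leq_subLR add1n -addnS -addSn leq_add.
  have H : (d1 < (d1 + d2).+1)%N by rewrite ltnS leq_addr.
  rewrite coefM (bigD1 (Ordinal H)) //= addKn big1 ?addr0 // => i.
  rewrite -val_eqE /= neq_ltn => /orP[lt|lt].
    rewrite [X in _ * X]nth_default ?mulr0 //; apply: leq_trans s2 _.
    by rewrite ltn_subRL ltn_add2r.
  by rewrite [X in X * _]nth_default ?mul0r //; apply: leq_trans s1 _.
have powD i m : (size (((u i)%:P + (w i)%:P * 'X) ^+ m)%R <= m.+1)%N /\
    (((u i)%:P + (w i)%:P * 'X) ^+ m)`_m = w i ^+ m.
  elim: m => [|m IH]; first by rewrite expr0 size_poly1 coef1.
  rewrite !exprS -[m.+1]add1n; apply: mulD => //; split.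
    apply: leq_trans (size_polyD _ _) _; rewrite geq_max.
    rewrite (leq_trans (size_polyC_leq1 _)) //= mul_polyC.
    by apply: leq_trans (size_scale_leq _ _) _; rewrite size_polyX.
  by rewrite coefD coefC /= add0r coefMX coefC.
rewrite /q; elim: s {q} => [|i s IH].
  by rewrite !big_nil size_poly1 coef1.
by rewrite !big_cons; apply: mulD.
Qed.

(** Restricting to a line gives a polynomial of degree at most [k] whose
    coefficient of degree [k] is the value at the direction [w]. The target ring
    is arbitrary: the reals, the complex numbers, and complex polynomials when
    the base point itself moves. *)
Lemma mmap_line (A : comNzRingType) (f : {rmorphism K -> A}) (u w : 'I_n -> A) :
  exists q : {poly A}, [/\ (size q <= k.+1)%N, q`_k = mmap f w p &
    forall t, q.[t] = mmap f (fun i => u i + t * w i) p].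
Proof.
exists (mmap (polyC \o f) (fun i => (u i)%:P + (w i)%:P * 'X) p).
have H m : m \in msupp p ->
    (size (mmap1 (fun i => (u i)%:P + (w i)%:P * 'X)%R m) <= k.+1)%N /\
    (mmap1 (fun i => (u i)%:P + (w i)%:P * 'X) m)`_k = mmap1 w m.
  move=> mp; have <- : mdeg m = k := dhomogP _ _ _ p_homog m mp.
  by rewrite mdegE /mmap1; exact: size_coef_prod_linear.
split.
- rewrite /mmap big_seq; apply: (leq_trans (size_sum _ _ _)).
  apply/bigmax_leqP_seq => m mp _.
  rewrite mul_polyC; apply: leq_trans (size_scale_leq _ _) _.
  by have [] := H m mp.
- rewrite /mmap coef_sum big_seq [RHS]big_seq; apply: eq_bigr => m mp.
  by rewrite mul_polyC coefZ; have [_ ->] := H m mp.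
- move=> t; rewrite -[LHS]/(horner_eval t _) mmap_rmorph.
  apply: eq_mmap => [a|i] /=; rewrite /horner_eval !hornerE //.
  by rewrite mulrC.
Qed.

End HomogeneousEvaluation.

(** * Real-rooted polynomials and geometric means *)

Section RealPolynomials.
Context (R : realType).

Lemma eq_poly_nat (F : numDomainType) (q1 q2 : {poly F}) :
  (forall j : nat, q1.[j%:R] = q2.[j%:R]) -> q1 = q2.
Proof.
move=> E; apply/eqP; rewrite -subr_eq0; apply/negPn/negP => nz.
have := @max_poly_roots _ _ [seq j%:R | j <- iota 0 (size (q1 - q2))] nz.
rewrite size_map size_iota ltnn => H; suff: false by []; apply: H.
  by apply/allP => _ /mapP[j _ ->]; rewrite /root !hornerE E subrr.
rewrite map_inj_uniq ?iota_uniq // => a b /eqP.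
by rewrite eqr_nat => /eqP.
Qed.

Lemma real_rooted_split (q : {poly R}) k : (size q <= k.+1)%N -> q`_k != 0 ->
  (forall z, root (map_poly (real_complex R) q) z -> complex.Im z = 0) ->
  exists mu : 'I_k -> R, forall t, q.[t] = q`_k * \prod_(i < k) (t + mu i).
Proof.
move=> sq qk re; set qC := map_poly _ q in re.
have sqC : (size qC <= k.+1)%N by rewrite size_map_poly.
have qCk : qC`_k = (q`_k)%:C by rewrite coef_map.
have [|s ss Dq] := horner_split sqC; first by rewrite qCk fmorph_eq0.
exists (fun i => - complex.Re s`_i) => t.
apply: (@complexI R); rewrite -[LHS]horner_map Dq qCk rmorphM rmorph_prod /=.
congr (_ * _); rewrite (big_nth 0) ss big_mkord; apply: eq_bigr => i _.
rewrite rmorphD rmorphN /=; congr (_ - _).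
have /re : root qC s`_i.
  rewrite /root Dq (big_rem s`_i) ?mem_nth ?ss //=.
  by rewrite subrr mul0r mulr0.
by case: (s`_i) => a b /= ->.
Qed.

(** Dividing by the right-hand side, the two terms become geometric means of
    the numbers [1 / (1 + l i)] and of [l i / (1 + l i)]; by AM-GM they are at
    most the arithmetic means, which add up to 1. *)
Lemma geometric_mean_superadditive k (l : 'I_k -> R) : (0 < k)%N ->
  (forall i, 0 < l i) ->
  1 + (\prod_(i < k) l i) `^ k%:R^-1 <= (\prod_(i < k) (1 + l i)) `^ k%:R^-1.
Proof.
move=> k0 l0.
have amgm (x : 'I_k -> R) : (forall i, 0 <= x i) ->
    (\prod_i x i) `^ k%:R^-1 <= (\sum_i x i) / k%:R.
  move=> x0; have mu0 : 0 <= (\sum_i x i) / k%:R.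
    by rewrite divr_ge0 ?sumr_ge0.
  have : \prod_i x i <= ((\sum_i x i) / k%:R) ^+ k.
    by have [] := @leif_AGM R _ 'I_k x (fun i _ => x0 i); rewrite card_ord.
  move=> /(ge0_ler_powR (r := k%:R^-1)); rewrite !nnegrE invr_ge0 ler0n.
  rewrite prodr_ge0 // exprn_ge0 // => /(_ isT isT isT) H.
  apply: le_trans H _.
  by rewrite -powR_mulrn // -powRrM mulfV ?powRr1 // pnatr_eq0 -lt0n.
have l1 i : 0 < 1 + l i by have := l0 i; lra.
have Q0 : 0 < \prod_(i < k) (1 + l i) by apply: prodr_gt0.
have h1 := amgm (fun i => (1 + l i)^-1)
  (fun i => ltW (etrans (invr_gt0 _) (l1 i))).
have h2 := amgm (fun i => l i / (1 + l i))
  (fun i => ltW (divr_gt0 (l0 i) (l1 i))).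
have sum1 : (\sum_i (1 + l i)^-1) / k%:R + (\sum_i l i / (1 + l i)) / k%:R = 1.
  rewrite -mulrDl -big_split /= (eq_bigr (fun=> 1)) => [|i _].
    by rewrite sumr_const card_ord mulfV // pnatr_eq0 -lt0n.
  by have := l1 i => /gt_eqF/negbT n0; field.
have G0 := powR_gt0 k%:R^-1 Q0.
have rootV : (\prod_i (1 + l i))^-1 `^ k%:R^-1 =
    ((\prod_i (1 + l i)) `^ k%:R^-1)^-1.
  have G0' : (\prod_i (1 + l i)) `^ k%:R^-1 != 0 by rewrite gt_eqF.
  apply: (mulIf G0'); rewrite mulVf // -powRM ?invr_ge0 ?(ltW Q0) //.
  by rewrite mulVf ?powR1 // gt_eqF.
have := lerD h1 h2; rewrite sum1 prodfV prodf_div.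
rewrite powRM ?prodr_ge0 ?invr_ge0 ?(ltW Q0) // => [|i _]; last exact: ltW.
by rewrite rootV -[X in X + _]mul1r -mulrDl ler_pdivrMr // mul1r.
Qed.

End RealPolynomials.

(** * Hyperbolic polynomials on complex points *)

Definition complex_eval (R : realType) n (p : mpoly n R) (z : 'I_n -> R[i]) :=
  mmap (real_complex R) z p.

Definition complex_coord (R : realType) (V : vectType R) (x : V)
    (i : 'I_(\dim {:V})) : R[i] := (coord (vbasis {:V}) i x)%:C.

Section Hyperbolic.
Context (R : realType) (V : vectType R) (k : nat) (P : V -> R).
Context (p : mpoly (\dim {:V}) R) (p_homog : p \is ishomog1 k mdeg).
Context (PE : forall x, P x = meval (fun i => coord (vbasis {:V}) i x) p).
Local Notation C := R[i].
Local Notation Im := (@complex.Im R).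
Local Notation Re := (@complex.Re R).
Local Notation PC := (complex_eval p).
Local Notation pt := (@complex_coord R V).
Local Notation hyp_eig e x := (@hyp_eigenvalue R V k P e x).
Local Notation cone := (hyperbolicity_cone k P).

Lemma complex_eval_coord x : PC (pt x) = (P x)%:C.
Proof. by rewrite PE /meval [RHS]mmap_rmorph. Qed.

Lemma complex_eval_real z x : z =1 pt x -> PC z = (P x)%:C.
Proof. by move=> zx; rewrite -complex_eval_coord; apply: eq_mmap. Qed.

Lemma complex_coordD x y i : pt (x + y) i = pt x i + pt y i.
Proof. by rewrite /complex_coord linearD rmorphD. Qed.

Lemma complex_coordZ c x i : pt (c *: x) i = c%:C * pt x i.
Proof. by rewrite /complex_coord linearZ rmorphM. Qed.

Lemma complex_eval_homog c z : PC (fun i => c * z i) = c ^+ k * PC z.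
Proof. exact: mmap_homog. Qed.

Lemma homogZ c x : P (c *: x) = c ^+ k * P x.
Proof.
apply: (@complexI R); rewrite -complex_eval_coord rmorphM rmorphXn /=.
rewrite -complex_eval_coord -complex_eval_homog.
by apply: eq_mmap => // i; rewrite complex_coordZ.
Qed.

(** The two restrictions of [P] to the line, to real and to complex parameters,
    come from one polynomial: the polynomials given by [mmap_line] over the two
    rings agree at all natural numbers. *)
Lemma P_line x w : exists q : {poly R}, [/\ (size q <= k.+1)%N, q`_k = P w,
  forall t, q.[t] = P (t *: w + x) &
  forall z, (map_poly (real_complex R) q).[z] =
    PC (fun i => z * pt w i + pt x i)].
Proof.
pose cr (y : V) i : R := coord (vbasis {:V}) i y.
have [q [sq qk qE]] := mmap_line p_homog idfun (cr x) (cr w).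
exists q; split => //.
- by rewrite qk PE.
- move=> t; rewrite qE PE; apply: eq_mmap => // i.
  by rewrite linearD linearZ /= addrC.
have [qC [sqC _ qCE]] := mmap_line p_homog (real_complex R) (pt x) (pt w).
suff -> : map_poly (real_complex R) q = qC.
  by move=> z; rewrite qCE; apply: eq_mmap => // i; rewrite addrC.
apply: eq_poly_nat => j; rewrite qCE -[j%:R](rmorph_nat (real_complex R)).
rewrite horner_map qE /= -[LHS]/(real_complex R _) mmap_rmorph.
by apply: eq_mmap => // i /=; rewrite rmorphD rmorphM.
Qed.

(** The real polynomial of [P_line] is the one given by hyperbolicity, so it
    splits over the reals: an ordering for [hyp_eigenvalue] to pick exists. *)
Lemma hyp_eigenvalueP e x : hyperbolic P e ->
  forall t : R, P (t *: e + x) = P e * \prod_(i < k) (t + hyp_eig e x i).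
Proof.
move=> [Pe /(_ x)[q qE q_re]].
have [q' [sq qk q'E _]] := P_line x e.
have {q'E} Dq : q = q' by apply: eq_poly_nat => j; rewrite q'E qE.
subst q'.
have [|mu Dmu] := real_rooted_split sq _ q_re; first by rewrite qk gt_eqF.
pose S := [set l : 'I_k -> R |
    forall t, P (t *: e + x) = P e * \prod_(i < k) (t + l i)].
rewrite -[forall t, _]/(S (xget (fun=> 0) S)); apply: (xgetPex _) => /=.
by exists mu => t; rewrite -qE Dmu qk.
Qed.

(** The factorization along [e] as an identity of binary forms in complex [u]
    and [v]: all values of [P] that have to be shown nonzero have this shape. *)
Lemma complex_eval_split e x u v : hyperbolic P e ->
  PC (fun i => u * pt e i + v * pt x i) =
  (P e)%:C * \prod_(i < k) (u + v * (hyp_eig e x i)%:C).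
Proof.
move=> He.
have main z : PC (fun i => z * pt e i + pt x i) =
    (P e)%:C * \prod_(i < k) (z + (hyp_eig e x i)%:C).
  have [q [_ _ qE qCE]] := P_line x e.
  rewrite -qCE.
  have -> : q = (P e)%:P * \prod_(i < k) ('X + (hyp_eig e x i)%:P).
    apply: eq_poly_nat => j; rewrite qE (hyp_eigenvalueP x He).
    rewrite hornerM hornerC horner_prod; congr (_ * _).
    by apply: eq_bigr => i _; rewrite !hornerE.
  rewrite rmorphM rmorph_prod /= hornerM map_polyC hornerC horner_prod /=.
  congr (_ * _); apply: eq_bigr => i _.
  by rewrite rmorphD /= map_polyX map_polyC !hornerE.
have [->|v0] := eqVneq v 0.
  under eq_bigr do rewrite mul0r addr0.
  rewrite prodr_const card_ord mulrC -complex_eval_coord -complex_eval_homog.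
  by apply: eq_mmap => // i; rewrite mul0r addr0.
rewrite (_ : PC _ = PC (fun i => v * ((u / v) * pt e i + pt x i))); last first.
  by apply: eq_mmap => // i; rewrite mulrDr mulrA mulrCA divff // mulr1.
rewrite complex_eval_homog main mulrCA; congr (_ * _).
rewrite -[in v ^+ k](card_ord k) -prodr_const -big_split /=.
by apply: eq_bigr => i _; rewrite mulrDr mulrCA divff // mulr1.
Qed.

Lemma P_split e x u v : hyperbolic P e ->
  P (u *: e + v *: x) = P e * \prod_(i < k) (u + v * hyp_eig e x i).
Proof.
move=> He; apply: (@complexI R).
rewrite rmorphM rmorph_prod /= -[LHS]/((P _)%:C) -complex_eval_coord.
rewrite (_ : PC _ = PC (fun i => u%:C * pt e i + v%:C * pt x i)).
  rewrite complex_eval_split //; congr (_ * _); apply: eq_bigr => i _.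
  by rewrite rmorphD rmorphM.
by apply: eq_mmap => // i; rewrite complex_coordD !complex_coordZ.
Qed.

Lemma complex_eval_homotopy (z0 z1 w : 'I_(\dim {:V}) -> C) : PC w != 0 ->
  (forall s t : R, 0 <= s <= 1 ->
     PC (fun i => z0 i + s%:C * z1 i + t%:C * w i) != 0) ->
  (forall t, 0 <= Im t -> PC (fun i => z0 i + t * w i) != 0) ->
  forall t, 0 <= Im t -> PC (fun i => z0 i + z1 i + t * w i) != 0.
Proof.
move=> w0 Hreal Hstart.
pose f : {rmorphism R -> {poly C}} := polyC \o real_complex R.
have [A [sA Ak AE]] := mmap_line p_homog f
  (fun i => (z0 i)%:P + (z1 i)%:P * 'X) (fun i => (w i)%:P).
have Aw : A`_k = (PC w)%:P by rewrite Ak /complex_eval mmap_rmorph.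
have AEE (s t : C) : A.[t%:P].[s] = PC (fun i => z0 i + s * z1 i + t * w i).
  rewrite AE -[LHS]/(horner_eval s _) mmap_rmorph.
  apply: eq_mmap => [a|i] /=; rewrite /horner_eval !hornerE //.
  by rewrite (mulrC s).
move=> t t0; rewrite (_ : PC _ = A.[t%:P].[1]).
  apply: root_free_homotopy sA Aw w0 _ _ t t0 => [s t s01|t t0].
    by rewrite AEE Hreal.
  rewrite AEE (_ : PC _ = PC (fun i => z0 i + t * w i)) ?Hstart //.
  by apply: eq_mmap => // i; rewrite mul0r addr0.
by rewrite AEE; apply: eq_mmap => // i; rewrite mul1r.
Qed.

(** * Convexity of the cone and concavity of the root *)

Lemma cone_gt0 e x : hyperbolic P e -> cone e x -> 0 < P x.
Proof.
move=> He Cx; rewrite -[x]add0r -(scale0r e) -[x]scale1r P_split //.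
have [Pe _] := He; rewrite mulr_gt0 // prodr_gt0 // => i _.
by rewrite add0r mul1r; exact: Cx.
Qed.

Lemma coneP e x : hyperbolic P e ->
  cone e x <-> forall t, 0 <= t -> P (t *: e + x) != 0.
Proof.
move=> He; have [Pe _] := He; split=> [Cx t t0|nz i].
  rewrite hyp_eigenvalueP // gt_eqF // mulr_gt0 // prodr_gt0 // => i _.
  by rewrite ltr_wpDl.
rewrite ltNge; apply/negP => li; have := nz (- hyp_eig e x i).
rewrite oppr_ge0 => /(_ li) /negP; apply; rewrite hyp_eigenvalueP //.
by rewrite (bigD1 i) //= addNr mul0r mulr0.
Qed.

Lemma complex_eval_cone_neq0 e x u v : hyperbolic P e ->
  (forall i, u + v * (hyp_eig e x i)%:C != 0) ->
  PC (fun i => u * pt e i + v * pt x i) != 0.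
Proof.
move=> He nz; have [Pe _] := He; rewrite complex_eval_split // mulf_neq0 //.
  by rewrite fmorph_eq0 gt_eqF.
by apply/prodf_neq0 => i _.
Qed.

Lemma complex_eval_coord_neq0 e x :
  hyperbolic P e -> cone e x -> PC (pt x) != 0.
Proof.
move=> He Cx.
by rewrite complex_eval_coord fmorph_eq0 gt_eqF // (cone_gt0 He Cx).
Qed.

(** Along the homotopy [s *: y] the zeros [t] stay off the real axis, because
    the factors of [P] at [i alpha e + x], [x] real, have imaginary part
    [alpha]. For [s = 0] each factor is [i alpha + t l] with [l > 0]. *)
Lemma complex_eval_upper_neq0 e a y (alpha : R) t : hyperbolic P e ->
  cone e a -> 0 < alpha -> 0 <= Im t ->
  PC (fun i => (0 +i* alpha) * pt e i + pt y i + t * pt a i) != 0.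
Proof.
move=> He Ca alpha0 t0.
have := complex_eval_homotopy (complex_eval_coord_neq0 He Ca)
  (z0 := fun i => (0 +i* alpha) * pt e i) (z1 := pt y) _ _ t0.
apply; [move=> s {t0}t _|move=> {t0}t t0].
  rewrite (_ : PC _ = PC (fun i =>
      (0 +i* alpha) * pt e i + 1 * pt (s *: y + t *: a) i)).
    apply: complex_eval_cone_neq0 => // i; apply/eqP => /(congr1 Im) /=.
    lra.
  by apply: eq_mmap => // i; rewrite mul1r complex_coordD !complex_coordZ addrA.
apply: complex_eval_cone_neq0 => // i; apply/eqP => /(congr1 Im).
by case: t t0 => c d /= d0; have := Ca i; nra.
Qed.

(** In [complex_eval_upper_neq0], the lower bound for the modulus given by
    [normc_horner_ge] does not depend on [alpha], so it survives at
    [alpha = 0]. The lower half-plane follows by conjugation. *)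
Lemma hyperbolic_in_cone e a : hyperbolic P e -> cone e a ->
  hyperbolic P a.
Proof.
move=> He Ca; have Pa := cone_gt0 He Ca; split => // y.
have [q [sq qk qE qCE]] := P_line y a; exists q => // z.
suff up w : root (map_poly (real_complex R) q) w -> ~ 0 < Im w.
  move=> rz; apply/eqP; rewrite eq_le !leNgt; apply/andP; split; apply/negP.
    exact: up.
  have rzc : root (map_poly (real_complex R) q) z^*%C.
    rewrite -complex_root_conj -map_poly_comp.
    rewrite (_ : map_poly _ q = map_poly (real_complex R) q) //.
    by apply: eq_map_poly => c; rewrite /= oppr0.
  by move=> z0; apply: (up _ rzc); case: (z) z0 => c d /=; rewrite oppr_gt0.
move=> rw w0.
(* r is the value at w a + y + alpha i e, as a polynomial in alpha. *)
have [r [_ _ rE]] := mmap_line p_homog (real_complex R)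
  (fun i => w * pt a i + pt y i) (fun i => 'i%C * pt e i).
pose c := Normc.normc (PC (pt a)) * Im w ^+ k.
have c0 : 0 < c.
  by rewrite mulr_gt0 ?exprn_gt0 // normc_gt0 (complex_eval_coord_neq0 He Ca).
have bound (s : R) : 0 < s -> c <= Normc.normc r.[s%:C].
  move=> s0; have [h [sh hk hE]] := mmap_line p_homog (real_complex R)
    (fun i => (0 +i* s) * pt e i + pt y i) (pt a).
  have -> : r.[s%:C] = h.[w].
    rewrite rE hE; apply: eq_mmap => // i.
    rewrite mulrA (_ : s%:C * 'i%C = 0 +i* s); first by ring.
    by simpc.
  rewrite /c /complex_eval -hk; apply: normc_horner_ge => //; last exact: ltW.
    by rewrite hk (complex_eval_coord_neq0 He Ca).
  by move=> t t0; rewrite hE; apply: complex_eval_upper_neq0.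
have r0 : Normc.normc r.[0%:C] < c.
  rewrite rE (_ : mmap _ _ _ = 0) ?Normc.normc0 //.
  apply: etrans (eqP rw); rewrite qCE; apply: eq_mmap => // i.
  by rewrite mul0r addr0.
have : nbhs (0 : R) [set s | Normc.normc r.[s%:C] < c].
  have := @continuous_normc_horner R r 0.
  move/(_ [set x | x < c]) => H; apply: H.
  by apply: open_nbhs_nbhs; split => //; exact: open_lt.
move=> /nbhs_ballP[d /= d0 /(_ (d / 2))]; rewrite /ball /= sub0r normrN.
rewrite gtr0_norm ?divr_gt0 // => /(_ _) H.
have /H : d / 2 < d by lra.
by rewrite ltNge bound ?divr_gt0.
Qed.

(** Factors of the form [- i t + l] with [t] and [l] real vanish only for
    [t = 0], and [P] is positive on the segment from [e] to [b]; so the zeros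
    [t] along the homotopy are never real. The factor [- i] turns the right
    half-plane, where the zeros of [P (z a + b)] are to be excluded, into the
    upper one. *)
Lemma cone_ray_neq0 e a b t : hyperbolic P e ->
  cone e a -> cone e b -> 0 <= t ->
  P (t *: a + b) != 0.
Proof.
move=> He Ca Cb t0; have Ha := hyperbolic_in_cone He Ca; have [Pe _] := He.
rewrite -(fmorph_eq0 (real_complex R)) /=.
rewrite -(@complex_eval_real (fun i => pt e i + (pt b i - pt e i) +
    (0 +i* t) * (- 'i%C * pt a i))); last first.
  move=> i; rewrite complex_coordD complex_coordZ addrC subrKC mulrA.
  by congr (_ * _ + _); simpc.
apply: (complex_eval_homotopy (z0 := pt e) (z1 := fun i => pt b i - pt e i)
  (w := fun i => - 'i%C * pt a i)) => //.
- rewrite complex_eval_homog mulf_neq0 ?(complex_eval_coord_neq0 He Ca) //.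
  by rewrite expf_neq0 // oppr_eq0 eq_complex /= oner_eq0 andbF.
- move=> s {t0}t /andP[s0 s1].
  pose bs := (1 - s) *: e + s *: b.
  rewrite (_ : PC _ = PC (fun i => (0 +i* (- t)) * pt a i + 1 * pt bs i)).
    have [->|tn0] := eqVneq t 0.
      rewrite (@complex_eval_real _ bs) => [|i].
        rewrite fmorph_eq0 P_split // mulf_neq0 ?gt_eqF //.
        apply: prodr_gt0 => i _; have := Cb i => l0.
        have [s1'|s1'] := ltP s (1/2); nra.
      by rewrite oppr0 (_ : 0 +i* 0 = 0) // mul0r add0r mul1r.
    apply: complex_eval_cone_neq0 => // i; apply/eqP => /(congr1 Im) /=.
    by move/eqP: tn0; lra.
  apply: eq_mmap => // i; rewrite mul1r /bs.
  rewrite complex_coordD !complex_coordZ rmorphB rmorph1.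
  rewrite mulrA (_ : t%:C * - 'i%C = 0 +i* (- t)); first by ring.
  by simpc.
- move=> z z0.
  rewrite (_ : PC _ = PC (fun i => 1 * pt e i + (z * - 'i%C) * pt a i)).
    apply: complex_eval_cone_neq0 => // i; apply/eqP => /(congr1 Re).
    by case: z z0 => c d /= d0; have := Ca i; nra.
  by apply: eq_mmap => // i; rewrite mul1r mulrA.
Qed.

Lemma cone_add e a b : hyperbolic P e -> cone e a ->
  cone e b -> cone e (a + b).
Proof.
move=> He Ca Cb; apply/coneP => // t t0.
rewrite addrCA -[a]scale1r; apply: (cone_ray_neq0 He) => //.
apply/coneP => // u u0; rewrite addrA -scalerDl.
have [/(_ Cb) nz _] := coneP b He.
by rewrite nz // addr_ge0.
Qed.

Lemma cone_scale e c x : hyperbolic P e -> 0 < c ->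
  cone e x -> cone e (c *: x).
Proof.
move=> He c0 Cx; apply/coneP => // t t0.
have -> : t *: e + c *: x = c *: ((t / c) *: e + x).
  by rewrite scalerDr scalerA mulrCA divff ?mulr1 // gt_eqF.
rewrite homogZ mulf_neq0 ?expf_neq0 ?(gt_eqF c0) //.
have [/(_ Cx) nz _] := coneP x He.
by rewrite nz // divr_ge0 // ltW.
Qed.

Context (k_gt0 : (0 < k)%N).

(** Relatively to [a], with respect to which [P] is hyperbolic too, [b] has
    positive eigenvalues [mu], and [P b / P a], [P (a + b) / P a] are the
    products of the [mu i] and of the [1 + mu i]. *)
Lemma root_superadditive e a b : hyperbolic P e ->
  cone e a -> cone e b ->
  P a `^ k%:R^-1 + P b `^ k%:R^-1 <= P (a + b) `^ k%:R^-1.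
Proof.
move=> He Ca Cb; have Ha := hyperbolic_in_cone He Ca.
have Pa := cone_gt0 He Ca.
have Cab : cone a b.
  by apply/coneP => // t; apply: (cone_ray_neq0 He).
have -> : P b = P a * \prod_(i < k) hyp_eig a b i.
  rewrite -[in LHS](add0r b) -(scale0r a) -[b in LHS]scale1r P_split //.
  by congr (_ * _); apply: eq_bigr => i _; rewrite add0r mul1r.
have -> : P (a + b) = P a * \prod_(i < k) (1 + hyp_eig a b i).
  rewrite -[in LHS](scale1r a) -[b in LHS]scale1r P_split //.
  by congr (_ * _); apply: eq_bigr => i _; rewrite mul1r.
rewrite !powRM ?(ltW Pa) //; last 2 first.
- by apply: prodr_ge0 => i _; rewrite addr_ge0 // ltW // Cab.
- by apply: prodr_ge0 => i _; rewrite ltW // Cab.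
rewrite -[X in X + _]mulr1 -mulrDr ler_wpM2l ?powR_ge0 //.
by apply: geometric_mean_superadditive.
Qed.

Lemma root_homog c x : 0 <= c -> 0 <= P x ->
  P (c *: x) `^ k%:R^-1 = c * P x `^ k%:R^-1.
Proof.
move=> c0 Px; rewrite homogZ powRM ?exprn_ge0 //; congr (_ * _).
by rewrite -powR_mulrn // -powRrM mulfV ?powRr1 // pnatr_eq0 -lt0n.
Qed.
End Hyperbolic.

(** * Monotonicity under symmetrization *)

Theorem theorem3p10 (R : realType) (V : vectType R) (k : nat) (P : V -> R)
    (e : V) (gT : finGroupType) (rho : gT -> 'End(V))
    (k_ge1 : (1 <= k)%N)
    (P_homog : homogeneous_polynomial k P)
    (P_hyp : hyperbolic P e)
    (rho_act : linear_action rho)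
    (rho_e : forall g, rho g e = e)
    (rho_P : forall g x, P (rho g x) = P x) :
  (forall x, hyperbolicity_cone k P e x ->
    [/\ forall g, hyperbolicity_cone k P e (rho g x),
        hyperbolicity_cone k P e (reynolds rho x),
        P x <= P (reynolds rho x) &
        P x `^ k%:R^-1 <= P (reynolds rho x) `^ k%:R^-1]) /\
  (convex_set (hyperbolicity_cone k P e) /\
   convex_function (hyperbolicity_cone k P e) (fun x => - (P x `^ k%:R^-1))).
Proof.
have [p p_homog PE] := P_homog.
set cone := hyperbolicity_cone k P e.
pose F x := P x `^ k%:R^-1.
have cone_pos x : cone x -> 0 < P x by exact: (cone_gt0 p_homog PE P_hyp).
have coneD a b : cone a -> cone b -> cone (a + b).
  exact: (cone_add p_homog PE P_hyp).
have coneZ c x : 0 < c -> cone x -> cone (c *: x).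
  exact: (cone_scale p_homog PE P_hyp).
have FD a b : cone a -> cone b -> F a + F b <= F (a + b).
  exact: (root_superadditive p_homog PE k_ge1 P_hyp).
have FZ c x : 0 < c -> cone x -> F (c *: x) = c * F x.
  move=> c0 Cx; apply: (root_homog p_homog PE k_ge1); rewrite ltW //.
  exact: cone_pos.
split; last split.
- move=> x Cx.
  have Cg g : cone (rho g x).
    apply/(coneP p_homog PE _ P_hyp) => t t0.
    rewrite -(rho_e g) -linearZ -linearD rho_P.
    by have [/(_ Cx) nz _] := coneP p_homog PE x P_hyp; exact: nz.
  have Fg g : F (rho g x) = F x by rewrite /F rho_P.
  (* Convexity and concavity for averages of several points come from addition
     of nonempty sums; the factor #|gT|^-1 is put in at the end. *)
  have sum_cone s : (0 < size s)%N -> cone (\sum_(g <- s) rho g x) /\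
      (size s)%:R * F x <= F (\sum_(g <- s) rho g x).
    elim: s => // g [|h s] IH _; first by rewrite big_seq1 mul1r Fg.
    have [//|Cs Fs] := IH; rewrite big_cons; split; first exact: coneD.
    apply: le_trans (FD _ _ (Cg g) Cs).
    by rewrite /= -natr1 mulrDl mul1r addrC Fg lerD2l.
  have szG : size (index_enum gT) = #|gT| by rewrite cardT enumT.
  have G0 : (0 < #|gT|)%N by apply/card_gt0P; exists 1%g.
  have [|Csum] := sum_cone (index_enum gT); first by rewrite szG.
  have G0' : 0 < #|gT|%:R :> R by rewrite ltr0n.
  rewrite szG -ler_pdivlMl // -FZ ?invr_gt0 // => FR.
  have CR : cone (reynolds rho x) by apply: coneZ; rewrite ?invr_gt0.
  split => //.
  have rootK y : cone y -> P y = F y `^ k%:R.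
    move=> /cone_pos/ltW Py.
    by rewrite /F -powRrM mulVf ?powRr1 // pnatr_eq0 -lt0n.
  by rewrite (rootK _ Cx) (rootK _ CR) ge0_ler_powR // nnegrE powR_ge0.
- apply/convex_setW => x y; rewrite !inE => Cx Cy t t0 t1; rewrite inE.
  apply: (coneD (t%:num *: x) ((1 - t%:num) *: y)); apply: coneZ => //.
  by rewrite subr_gt0.
- move=> t x y; rewrite !inE => Cx Cy.
  have [->|t0] := eqVneq t 0%:i01; first by rewrite !conv0.
  have [->|t1] := eqVneq t 1%:i01; first by rewrite !conv1.
  have {}t0 : 0 < t%:num by rewrite lt_neqAle eq_sym t0 ge0.
  have {}t1 : 0 < 1 - t%:num by rewrite subr_gt0 lt_neqAle t1 le1.
  rewrite convRE !mulrN -opprD lerN2 -!FZ //.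
  by apply: FD; apply: coneZ.
Qed.
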